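(* For $(e,f,g)\in\mathbb C^3$ let $E_{e,f,g}$ be the curve $y^2=x^4+e\,x^2z^2+f\,xz^3+g\,z^4$ in the weighted projective plane $\mathbb P_{112}$ with coordinates $(z:x:y)$ of weights $1,1,2$. Then $E_{e,f,g}$ is singular if and only if $$\Delta:\quad 4e^3f^2+27f^4-16e^4g+128e^2g^2-144egf^2-256g^3=0,$$ and in this case it is of exactly one of the following four types: 1. ($\Delta_4$) if $e=f=g=0$: the union of two nonsingular rational curves meeting at one point and tangent to each other at that point; 2. ($\Delta_{22}$) if $g\neq0$, $f=0$, $e^2=4g$: the union of two nonsingular rational curves meeting transversally at two points; 3. ($\Delta_{13}$) if $e\ne0$, $8e^3+27f^2=0$, $e^2+12g=0$: a curve with a single singular point, a cusp; 4. ($\Delta_{112}$) if $\Delta$ vanishes and none of the conditions in 1–3 hold: a curve with a single singular point, a node.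
   Context: These curves are the possible fibers of $E_7$ elliptic fibrations, i.e. fibrations defined by the equation $y^2=x^4+e\,x^2z^2+f\,xz^3+g\,z^4$ in a bundle of weighted projective planes $\mathbb P_{112}$ over a base, with $e,f,g$ varying over the base. *)

(* Defs.v *)
(* The field of complex numbers is R[i] for R : realType. *)
From mathcomp Require Export all_boot all_order all_algebra.
From mathcomp Require Export reals complex mpoly.

Set Implicit Arguments.
Unset Strict Implicit.
Unset Printing Implicit Defensive.

Import GRing.Theory.
Local Open Scope ring_scope.

(* Weighted projective spaces are handled through homogeneous coordinates: a
   point is an n-tuple with some nonzero entry, up to the relation [weq w]. *)

Definition is_point (C : fieldType) (n : nat) (p : n.-tuple C) : bool :=
  has (fun a => a != 0) p.

Definition weq (C : fieldType) (n : nat) (w : n.-tuple nat)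
    (p q : n.-tuple C) : Prop :=
  exists2 t : C, t != 0 & forall i, tnth q i = t ^+ tnth w i * tnth p i.

Definition whomog (C : fieldType) (n : nat) (w : n.-tuple nat) (d : nat)
    (F : {mpoly C[n]}) : Prop :=
  forall m, m \in msupp F -> (\sum_(i < n) tnth w i * m i)%N = d.

Definition w11 : 2.-tuple nat := [tuple 1; 1]%N.
Definition w112 : 3.-tuple nat := [tuple 1; 1; 2]%N.

(* The polynomial F stands for the curve F = 0; a tuple p for its point. *)
Definition on_curve (C : fieldType) (n : nat) (F : {mpoly C[n]})
    (p : n.-tuple C) : Prop :=
  F.@[tnth p] = 0.

(* The coordinates of P_112 are indexed by 0 (z), 1 (x) and 2 (y).  Off the
   vertex (0 : 0 : 1) the surface is covered by the charts z <> 0 and x <> 0,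
   both isomorphic to the affine plane, with coordinates (x/z, y/z^2) and
   (z/x, y/x^2).  The vertex, where P_112 itself is singular, is in neither
   chart; no curve y^2 = ... (nor any of its components) contains it. *)
Inductive chart := Chart_z | Chart_x.

Definition in_chart (C : fieldType) (k : chart) (p : 3.-tuple C) : Prop :=
  match k with Chart_z => p`_0 != 0 | Chart_x => p`_1 != 0 end.

Definition chart_point (C : fieldType) (k : chart) (p : 3.-tuple C) :
    2.-tuple C :=
  match k with
  | Chart_z => [tuple p`_1 / p`_0; p`_2 / p`_0 ^+ 2]
  | Chart_x => [tuple p`_0 / p`_1; p`_2 / p`_1 ^+ 2]
  end.

Definition chart_eqn (C : fieldType) (k : chart) (F : {mpoly C[3]}) :
    {mpoly C[2]} :=
  match k with
  | Chart_z => F \mPo [tuple 1; 'X_0; 'X_1]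
  | Chart_x => F \mPo [tuple 'X_0; 1; 'X_1]
  end.

(* Local notions for a plane affine curve G = 0 at one of its points q. *)

Definition affine_singular (C : fieldType) (G : {mpoly C[2]})
    (q : 2.-tuple C) : Prop :=
  [/\ on_curve G q, on_curve G^`M(0) q & on_curve G^`M(1) q].

Definition affine_nonsingular (C : fieldType) (G : {mpoly C[2]})
    (q : 2.-tuple C) : Prop :=
  on_curve G q /\ ~ affine_singular G q.

Definition jacobian (C : fieldType) (G1 G2 : {mpoly C[2]}) : {mpoly C[2]} :=
  G1^`M(0) * G2^`M(1) - G1^`M(1) * G2^`M(0).

(* Two curves, nonsingular at the common point q, with distinct
   (resp. equal) tangent lines there. *)
Definition affine_transversal (C : fieldType) (G1 G2 : {mpoly C[2]})
    (q : 2.-tuple C) : Prop :=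
  [/\ affine_nonsingular G1 q, affine_nonsingular G2 q
    & ~ on_curve (jacobian G1 G2) q].

Definition affine_tangent (C : fieldType) (G1 G2 : {mpoly C[2]})
    (q : 2.-tuple C) : Prop :=
  [/\ affine_nonsingular G1 q, affine_nonsingular G2 q
    & on_curve (jacobian G1 G2) q].

Definition translate (C : fieldType) (G : {mpoly C[2]}) (q : 2.-tuple C) :
    {mpoly C[2]} :=
  G \mPo [tuple 'X_0 + (q`_0)%:MP; 'X_1 + (q`_1)%:MP].

(* Degree d form in the Taylor expansion of G at q. *)
Definition taylor_form (C : fieldType) (d : nat) (G : {mpoly C[2]})
    (q : 2.-tuple C) : {mpoly C[2]} :=
  pihomog mdeg d (translate G q).

Definition double_point (C : fieldType) (G : {mpoly C[2]})
    (q : 2.-tuple C) : Prop :=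
  [/\ taylor_form 0 G q = 0, taylor_form 1 G q = 0 & taylor_form 2 G q != 0].

Definition linear_form (C : fieldType) (l : C * C) : {mpoly C[2]} :=
  l.1 *: 'X_0 + l.2 *: 'X_1.

(* Intersection multiplicity at q of G = 0 with the line through q on which
   the linear form l vanishes (0 if that line is a component of G = 0, where
   the true value is infinite). *)
Definition line_mult (C : fieldType) (G : {mpoly C[2]}) (q : 2.-tuple C)
    (l : C * C) : nat :=
  mup 0 (mmap polyC (fun i => tnth [tuple l.2; - l.1] i *: 'X)
           (translate G q)).

(* Node: a double point with two distinct tangent lines. *)
Definition affine_node (C : fieldType) (G : {mpoly C[2]})
    (q : 2.-tuple C) : Prop :=
  double_point G q /\
  exists l l' : C * C, l.1 * l'.2 != l.2 * l'.1 /\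
    taylor_form 2 G q = linear_form l * linear_form l'.

(* Cusp (Fulton, Algebraic Curves, Ch. 3): a double point with only one
   tangent line, meeting the curve there with multiplicity exactly 3.  Over a
   closed field the constant in front of the square can be absorbed in l. *)
Definition affine_cusp (C : fieldType) (G : {mpoly C[2]})
    (q : 2.-tuple C) : Prop :=
  double_point G q /\
  exists l : C * C, taylor_form 2 G q = linear_form l ^+ 2 /\
    line_mult G q l = 3%N.

(* The corresponding notions at a point of P_112. *)

Definition at_point (C : fieldType)
    (P : {mpoly C[2]} -> 2.-tuple C -> Prop)
    (F : {mpoly C[3]}) (p : 3.-tuple C) : Prop :=
  exists2 k, in_chart k p & P (chart_eqn k F) (chart_point k p).

Definition at_point2 (C : fieldType)
    (P : {mpoly C[2]} -> {mpoly C[2]} -> 2.-tuple C -> Prop)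
    (F1 F2 : {mpoly C[3]}) (p : 3.-tuple C) : Prop :=
  exists2 k, in_chart k p &
    P (chart_eqn k F1) (chart_eqn k F2) (chart_point k p).

Definition singular_at (C : fieldType) := at_point (@affine_singular C).
Definition nonsingular_at (C : fieldType) := at_point (@affine_nonsingular C).
Definition node_at (C : fieldType) := at_point (@affine_node C).
Definition cusp_at (C : fieldType) := at_point (@affine_cusp C).
Definition transversal_at (C : fieldType) := at_point2 (@affine_transversal C).
Definition tangent_at (C : fieldType) := at_point2 (@affine_tangent C).

Definition singular_curve (C : fieldType) (F : {mpoly C[3]}) : Prop :=
  exists p, is_point p /\ singular_at F p.

(* Holds only for curves missing the vertex. *)
Definition nonsingular_curve (C : fieldType) (F : {mpoly C[3]}) : Prop :=
  forall p, is_point p -> on_curve F p -> nonsingular_at F p.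

Definition irreducible_curve (C : fieldType) (F : {mpoly C[3]}) : Prop :=
  [/\ exists d, whomog w112 d F, F != 0, F \isn't a GRing.unit
    & forall G H, F = G * H -> G \is a GRing.unit \/ H \is a GRing.unit].

(* A tuple of forms, the i-th of degree d * w'_i for some d, is a rational
   map between weighted projective spaces, undefined where all the forms
   vanish. *)
Definition is_ratmap (C : fieldType) (n k : nat) (w : n.-tuple nat)
    (w' : k.-tuple nat) (phi : k.-tuple {mpoly C[n]}) : Prop :=
  exists d, forall i, whomog w (d * tnth w' i)%N (tnth phi i).

Definition ratmap (C : fieldType) (n k : nat) (phi : k.-tuple {mpoly C[n]})
    (p : n.-tuple C) : k.-tuple C :=
  [tuple (tnth phi i).@[tnth p] | i < k].

(* F = 0 is birational to P^1: there are rational maps phi and psi, defined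
   and inverse to each other outside finite sets S and T of points. *)
Definition birational_to_P1 (C : fieldType) (F : {mpoly C[3]}) : Prop :=
  exists (phi : 3.-tuple {mpoly C[2]}) (psi : 2.-tuple {mpoly C[3]})
         (S : seq (2.-tuple C)) (T : seq (3.-tuple C)),
  [/\ is_ratmap w11 w112 phi, is_ratmap w112 w11 psi,
      forall s, is_point s -> (forall s', s' \in S -> ~ weq w11 s' s) ->
        [/\ is_point (ratmap phi s), on_curve F (ratmap phi s),
            is_point (ratmap psi (ratmap phi s))
          & weq w11 (ratmap psi (ratmap phi s)) s]
    & forall p, is_point p -> on_curve F p ->
        (forall p', p' \in T -> ~ weq w112 p' p) ->
        [/\ is_point (ratmap psi p), is_point (ratmap phi (ratmap psi p))
          & weq w112 (ratmap phi (ratmap psi p)) p]].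

Definition nonsingular_rational_curve (C : fieldType) (F : {mpoly C[3]}) :
    Prop :=
  [/\ irreducible_curve F, nonsingular_curve F & birational_to_P1 F].

Definition on_both (C : fieldType) (F1 F2 : {mpoly C[3]}) (p : 3.-tuple C) :
    Prop :=
  [/\ is_point p, on_curve F1 p & on_curve F2 p].

(* Unions are taken with their scheme structure, i.e. as products F1 * F2. *)

Definition two_tangent_rational_curves (C : fieldType) (F : {mpoly C[3]}) :
    Prop :=
  exists F1 F2 : {mpoly C[3]},
  [/\ F = F1 * F2, nonsingular_rational_curve F1,
      nonsingular_rational_curve F2
    & exists p, [/\ on_both F1 F2 p, tangent_at F1 F2 p
        & forall q, on_both F1 F2 q -> weq w112 p q]].

Definition two_transversal_rational_curves (C : fieldType)
    (F : {mpoly C[3]}) : Prop :=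
  exists F1 F2 : {mpoly C[3]},
  [/\ F = F1 * F2, nonsingular_rational_curve F1,
      nonsingular_rational_curve F2
    & exists p p', [/\ ~ weq w112 p p',
        on_both F1 F2 p /\ transversal_at F1 F2 p,
        on_both F1 F2 p' /\ transversal_at F1 F2 p'
        & forall q, on_both F1 F2 q -> weq w112 p q \/ weq w112 p' q]].

Definition single_singular_point (C : fieldType) (F : {mpoly C[3]})
    (p : 3.-tuple C) : Prop :=
  [/\ is_point p, singular_at F p
    & forall q, is_point q -> singular_at F q -> weq w112 p q].

Definition cuspidal_curve (C : fieldType) (F : {mpoly C[3]}) : Prop :=
  exists p, single_singular_point F p /\ cusp_at F p.

Definition nodal_curve (C : fieldType) (F : {mpoly C[3]}) : Prop :=
  exists p, single_singular_point F p /\ node_at F p.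

Inductive singular_type := Delta4 | Delta22 | Delta13 | Delta112.

Definition has_type (C : fieldType) (F : {mpoly C[3]}) (k : singular_type) :
    Prop :=
  match k with
  | Delta4 => two_tangent_rational_curves F
  | Delta22 => two_transversal_rational_curves F
  | Delta13 => cuspidal_curve F
  | Delta112 => nodal_curve F
  end.

Definition E7_curve (C : fieldType) (e f g : C) : {mpoly C[3]} :=
  let z := 'X_0 in let x := 'X_1 in let y := 'X_2 in
  y ^+ 2 - (x ^+ 4 + e *: (x ^+ 2 * z ^+ 2) + f *: (x * z ^+ 3) + g *: z ^+ 4).

Definition discr (C : fieldType) (e f g : C) : C :=
  4 * e ^+ 3 * f ^+ 2 + 27 * f ^+ 4 - 16 * e ^+ 4 * g + 128 * e ^+ 2 * g ^+ 2
  - 144 * e * g * f ^+ 2 - 256 * g ^+ 3.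

(* Main.v *)
(* Near z = 0 the curve is y^2 = 1 + ..., hence nonsingular, so its singular
   points are the points (1 : a : 0) with a a double root of the quartic
   q = x^4 + e x^2 + f x + g, whose discriminant is - discr e f g.  As the roots
   of q add up to 0, two distinct double roots are a and - a, which means
   q = (x^2 - a^2)^2; then, as for q = x^4, the curve splits into
   y = x^2 - a^2 z^2 and y = - x^2 + a^2 z^2, which are isomorphic to P^1.
   In the other cases the singular point is unique, and it is a node when
   q''(a) = 2 (6 a^2 + e) is nonzero, a cusp when it vanishes and a <> 0.
   Conversely, two components meeting transversally at two points yield two
   double roots, and a tangency forces q to vanish to order 4, so q = x^4. *)
Require Import Defs.
From mathcomp Require Import ring.

Set Implicit Arguments.
Unset Strict Implicit.
Unset Printing Implicit Defensive.
Import GRing.Theory Num.Theory.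
Local Open Scope ring_scope.

(** * Double roots of depressed quartics *)

Definition double_root (C : fieldType) (e f g a : C) : Prop :=
  a ^+ 4 + e * a ^+ 2 + f * a + g = 0 /\ 4 * a ^+ 3 + 2 * e * a + f = 0.

(** Both equations are linear in [f] and [g], so [e] and [a] parametrise the quartics with double
    root [a]. *)
Lemma double_rootE (C : fieldType) (e f g a : C) :
  double_root e f g a <->
  f = - (4 * a ^+ 3 + 2 * e * a) /\ g = 3 * a ^+ 4 + e * a ^+ 2.
Proof.
split=> [[q0 q1]|[-> ->]]; last by split; ring.
have Df : f = - (4 * a ^+ 3 + 2 * e * a).
  by apply/eqP; rewrite -subr_eq0 opprK addrC q1.
split=> //; apply/eqP; rewrite -subr_eq0; apply/eqP; rewrite -[RHS]q0 Df; ring.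
Qed.

(* The roots of x^4 + e x^2 + f x + g are r1, r2, r3 and - (r1 + r2 + r3): r2 is
   a root of its quotient by x - r1, and r3 of the quotient by (x - r1)(x - r2). *)
Lemma closed_quartic_factor (C : closedFieldType) (e f g : C) :
  exists r1 r2 r3,
    [/\ e = - (r3 ^+ 2 + (r1 + r2) * r3 + r2 ^+ 2 + r1 * r2 + r1 ^+ 2),
        f = - (r2 ^+ 3 + r1 * r2 ^+ 2 + (r1 ^+ 2 + e) * r2 + r1 ^+ 3 + e * r1)
      & g = - (r1 ^+ 4 + e * r1 ^+ 2 + f * r1)].
Proof.
(* [solve_monicpoly] solves x^n = sum of P_i x^i, hence the opposite signs of the coefficients. *)
have [r1 E1] := @solve_monicpoly C 4 (nth 0 [:: - g; - f; - e]) isT.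
have [r2 E2] := @solve_monicpoly C 3
  (nth 0 [:: - (r1 ^+ 3 + e * r1 + f); - (r1 ^+ 2 + e); - r1]) isT.
have [r3 E3] := @solve_monicpoly C 2
  (nth 0 [:: - (r2 ^+ 2 + r1 * r2 + r1 ^+ 2 + e); - (r1 + r2)]) isT.
move: E1 E2 E3; rewrite !big_ord_recl !big_ord0 /= => E1 E2 E3.
have De : e = - (r3 ^+ 2 + (r1 + r2) * r3 + r2 ^+ 2 + r1 * r2 + r1 ^+ 2).
  rewrite E3 /=; ring.
by exists r1, r2, r3; split=> //; [rewrite E2 | rewrite E1] => /=; ring.
Qed.

Lemma discr_eq0 (C : closedFieldType) (e f g : C) :
  discr e f g = 0 <-> exists a, double_root e f g a.
Proof.
split=> [|[a /double_rootE[-> ->]]]; last by rewrite /discr; ring.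
have [r1 [r2 [r3 [De Df Dg]]]] := closed_quartic_factor e f g.
(* The six factors are the differences of the roots; those with a coefficient 2 are r_i - r4, where
   r4 = - (r1 + r2 + r3). *)
have -> : discr e f g = - ((r1 - r2) * (r1 - r3) * (2 * r1 + r2 + r3) *
    (r2 - r3) * (r1 + 2 * r2 + r3) * (r1 + r2 + 2 * r3)) ^+ 2.
  rewrite /discr Dg Df De; ring.
move/eqP; rewrite oppr_eq0 expf_eq0 /= !mulf_eq0.
have sol (x y : C) : x - y == 0 -> x = y by rewrite subr_eq0 => /eqP.
case/orP=> [/orP[/orP[/orP[/orP[]|]|]|]|] D.
- exists r1; rewrite /double_root Dg Df De -(sol _ _ D); split; ring.
- exists r1; rewrite /double_root Dg Df De -(sol _ _ D); split; ring.
- have D3 : r3 = - (2 * r1 + r2) by apply/eqP; rewrite -addr_eq0 addrC.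
  by exists r1; rewrite /double_root Dg Df De D3; split; ring.
- exists r2; rewrite /double_root Dg Df De -(sol _ _ D); split; ring.
- have D3 : r3 = - (r1 + 2 * r2) by apply/eqP; rewrite -addr_eq0 addrC.
  by exists r2; rewrite /double_root Dg Df De D3; split; ring.
- have D1 : r1 = - (r2 + 2 * r3) by apply/eqP; rewrite -addr_eq0 addrA.
  by exists r3; rewrite /double_root Dg Df De D1; split; ring.
Qed.

(** Subtracting the formulas for [f] and [g] at [a] and [b] and dividing by [b - a] leaves two
    relations; eliminating [e] gives (a + b) (b - a)^2 = 0, so b = - a and the quartic is (x^2 -
    a^2)^2. *)
Lemma two_double_roots (C : numFieldType) (e f g a b : C) :
  double_root e f g a -> double_root e f g b -> a != b ->
  [/\ a != 0, e = - (2 * a ^+ 2), f = 0 & g = a ^+ 4].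
Proof.
move=> /double_rootE[Df Dg] /double_rootE[Df' Dg'] neq_ab.
have nz : b - a != 0 by rewrite subr_eq0 eq_sym.
have E1 : 4 * (a ^+ 2 + a * b + b ^+ 2) + 2 * e = 0.
  apply: (mulfI nz); rewrite mulr0; transitivity (f - f); last exact: subrr.
  by rewrite {1}Df Df'; ring.
have E2 : 3 * (a + b) * (a ^+ 2 + b ^+ 2) + e * (a + b) = 0.
  apply: (mulfI nz); rewrite mulr0; transitivity (g - g); last exact: subrr.
  by rewrite {1}Dg' Dg; ring.
have De : e = - (2 * (a ^+ 2 + a * b + b ^+ 2)).
  apply: (@mulfI _ 2); first by rewrite pnatr_eq0.
  by apply/eqP; rewrite -subr_eq0 -E1; apply/eqP; ring.
have Db : b = - a.
  have /eqP : (a + b) * (b - a) ^+ 2 = 0 by rewrite -E2 De; ring.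
  by rewrite mulf_eq0 expf_eq0 (negPf nz) orbF addrC addr_eq0 => /eqP.
have De' : e = - (2 * a ^+ 2) by rewrite De Db; ring.
split=> //; last 2 first.
- by rewrite Df De'; ring.
- by rewrite Dg De'; ring.
by apply: contra_neqN nz => /eqP a0; rewrite Db a0; ring.
Qed.

(** * Double covers of the affine line *)

Lemma mderivXU (C : fieldType) n (i j : 'I_n) :
  ('X_i : {mpoly C[n]})^`M(j) = (i == j)%:R.
Proof.
rewrite mderivX mnm1E; case: eqVneq => [->|_]; last exact: scale0r.
have -> : (U_(j) - U_(j) = 0 :> 'X_{1..n})%MM.
  by apply/mnmP=> l; rewrite mnmBE subnn mnm0E.
by rewrite mpolyX0 scale1r.
Qed.

(** * Univariate polynomials evaluated at a variable *)

Section HornerAlg.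
Variables (C : fieldType) (n : nat).
Implicit Types (p : {poly C}) (i : 'I_n).

Lemma meval_horner_alg p i (v : 'I_n -> C) :
  (horner_alg ('X_i : {mpoly C[n]}) p).@[v] = p.[v i].
Proof.
elim/poly_ind: p => [|p c IHp]; first by rewrite rmorph0 meval0 horner0.
rewrite rmorphD rmorphM /= horner_algX horner_algC mevalD mevalM IHp mevalXU.
by rewrite alg_mpolyC mevalC !hornerE.
Qed.

Lemma mderiv_horner_alg p i j :
  (horner_alg ('X_i : {mpoly C[n]}) p)^`M(j) =
    if i == j then horner_alg 'X_i p^`() else 0.
Proof.
elim/poly_ind: p => [|p c IHp]; first by rewrite deriv0 !rmorph0 mderiv0; case: ifP.
rewrite rmorphD rmorphM /= horner_algX horner_algC mderivD mderivM IHp mderivXU.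
rewrite alg_mpolyC mderivC addr0; case: eqVneq => [->|_] /=; last first.
  by rewrite mulr0 mul0r addr0.
rewrite mulr1 derivD derivM derivX derivC addr0 mulr1.
by rewrite rmorphD rmorphM /= horner_algX.
Qed.

Lemma comp_mpoly_horner_alg k p i (t : n.-tuple {mpoly C[k]}) :
  horner_alg ('X_i : {mpoly C[n]}) p \mPo t = horner_alg (t`_i) p.
Proof.
elim/poly_ind: p => [|p c IHp]; first by rewrite !rmorph0.
rewrite !rmorphD !rmorphM /= !horner_algX !horner_algC IHp comp_mpolyXU.
by rewrite !alg_mpolyC comp_mpolyC.
Qed.

Lemma horner_alg_comp (A : algType C) (a : A) (p q : {poly C}) :
  horner_alg (horner_alg a q) p = horner_alg a (p \Po q).
Proof.
elim/poly_ind: p => [|p c IHp]; first by rewrite comp_poly0 !rmorph0.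
rewrite comp_polyD comp_polyM comp_polyX comp_polyC.
by rewrite !rmorphD !rmorphM /= !horner_algX !horner_algC IHp.
Qed.

Lemma pihomog_horner_alg d p i :
  pihomog mdeg d (horner_alg ('X_i : {mpoly C[n]}) p) = p`_d *: 'X_i ^+ d.
Proof.
rewrite -{1}[p]coefK poly_def !raddf_sum /=.
have E (j : 'I_(size p)) :
    pihomog mdeg d (horner_alg ('X_i : {mpoly C[n]}) (p`_j *: 'X^j)) =
    if j == d :> nat then p`_d *: 'X_i ^+ d else 0.
  rewrite -mul_polyC rmorphM rmorphXn /= horner_algX horner_algC alg_mpolyC.
  rewrite mul_mpolyC linearZ /= !mpolyXn pihomogX /=.
  by rewrite mdegMn mdeg1 mul1n; case: eqVneq => [->|]; rewrite ?scaler0.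
under eq_bigr do rewrite E.
(* Only j = d survives; if d is at least the size of [p], there is no such index and the coefficient
   of degree d is the default 0. *)
rewrite -big_mkcond /=; case: (ltnP d (size p)) => lt_d.
  by rewrite (big_pred1 (Ordinal lt_d)).
rewrite big1 => [|j /eqP Dj]; first by rewrite nth_default ?scale0r.
by have := ltn_ord j; rewrite Dj ltnNge lt_d.
Qed.

Lemma mmap_polyC_horner_alg p i (h : 'I_n -> {poly C}) :
  mmap polyC h (horner_alg ('X_i : {mpoly C[n]}) p) = p \Po h i.
Proof.
elim/poly_ind: p => [|p c IHp]; first by rewrite !rmorph0.
rewrite rmorphD rmorphM /= horner_algX horner_algC alg_mpolyC.
rewrite mmapD mmapC comp_polyD comp_polyM comp_polyX comp_polyC -IHp.
by rewrite rmorphM /= mmapX mmap1U.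
Qed.

End HornerAlg.

(** Both charts of an E7 curve have an equation y^2 = p(x), so the local study is done once for this
    form. *)
Definition double_cover (C : fieldType) (p : {poly C}) : {mpoly C[2]} :=
  'X_1 ^+ 2 - horner_alg 'X_0 p.

(** The factor X^n contributes exactly n, and 0 is a root of the quotient by X^n iff its constant
    term, p_n, vanishes. *)
Lemma mup0_eq (C : fieldType) (p : {poly C}) n : p != 0 ->
  (forall i, (i < n)%N -> p`_i = 0) -> (mup 0 p == n) = (p`_n != 0).
Proof.
move=> nz_p p0.
have Dp : p = 'X^n * drop_poly n p.
  rewrite -{1}[p](poly_take_drop n) mulrC; have -> : take_poly n p = 0.
    by apply/polyP=> i; rewrite coef_take_poly coef0; case: ifP => // /p0.
  by rewrite add0r.
have nz_d : drop_poly n p != 0 by apply: contra_neq nz_p => d0; rewrite Dp d0 mulr0.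
have -> : mup 0 p = (n + mup 0 (drop_poly n p))%N.
  rewrite {1}Dp mupM ?expf_neq0 ?polyX_eq0 //.
  by have := mup_XsubCX n (0 : C) 0; rewrite subr0 eqxx => ->.
rewrite -[X in _ == X]addn0 eqn_add2l -leqn0 leqNgt -XsubC_dvd // dvdp_XsubCl.
by rewrite rootE horner_coef0 coef_drop_poly.
Qed.

(** These are the Taylor coefficients of [p] at [u], cleared of factorial denominators; derivation
    commutes with the shift. *)
Lemma coef_shift (C : numFieldType) (p : {poly C}) (u : C) :
  let t := p \Po ('X + u%:P) in
  [/\ t`_0 = p.[u], t`_1 = p^`().[u], t`_2 *+ 2 = p^`()^`().[u]
    & t`_3 *+ 6 = p^`()^`()^`().[u]].
Proof.
have D (r : {poly C}) : (r \Po ('X + u%:P))^`() = r^`() \Po ('X + u%:P).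
  by rewrite deriv_comp derivD derivX derivC addr0 mulr1.
have E (r : {poly C}) : r.[u] = (r \Po ('X + u%:P))`_0.
  by rewrite -horner_coef0 horner_comp !hornerE.
move=> t; rewrite !E -!D -/t !coef_deriv; split=> //.
by rewrite -!mulrnA.
Qed.

Section DoubleCover.
Variable C : numFieldType.
Implicit Types (p : {poly C}) (q : 2.-tuple C).

Lemma on_double_cover p q :
  on_curve (double_cover p) q <-> q`_1 ^+ 2 = p.[q`_0].
Proof.
rewrite /on_curve mevalB meval_horner_alg rmorphXn /= mevalXU !(tnth_nth 0) /=.
by split=> [/eqP|->]; rewrite ?subrr ?subr_eq0 // => /eqP.
Qed.

Lemma mderiv0_double_cover p : (double_cover p)^`M(0) = - horner_alg 'X_0 p^`().
Proof.
rewrite mderivB mderiv_horner_alg eqxx expr2 mderivM mderivXU /=.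
by rewrite mulr0 mul0r addr0 sub0r.
Qed.

Lemma mderiv1_double_cover p : (double_cover p)^`M(1) = 2 *: 'X_1.
Proof.
rewrite mderivB mderiv_horner_alg /= subr0 expr2 mderivM mderivXU /=.
by rewrite mul1r mulr1 scaler_nat mulr2n.
Qed.

(** The derivative 2 y vanishes only for y = 0, as the characteristic is 0. *)
Lemma affine_singular_double_cover p q :
  affine_singular (double_cover p) q <->
  [/\ q`_1 = 0, p.[q`_0] = 0 & p^`().[q`_0] = 0].
Proof.
have E0 : on_curve (double_cover p)^`M(0) q <-> - p^`().[q`_0] = 0.
  by rewrite /on_curve mderiv0_double_cover mevalN meval_horner_alg (tnth_nth 0).
have E1 : on_curve (double_cover p)^`M(1) q <-> 2 * q`_1 = 0.
  by rewrite /on_curve mderiv1_double_cover mevalZ mevalXU (tnth_nth 0).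
split=> [[/on_double_cover q0 /E0/eqP q1 /E1/eqP q2]|[q2 q0 q1]].
  have {}q2 : q`_1 = 0 by move: q2; rewrite mulf_eq0 pnatr_eq0 /= => /eqP.
  split=> //; first by rewrite -q0 q2 expr0n.
  by apply/eqP; rewrite -oppr_eq0.
split; [apply/on_double_cover | apply/E0 | apply/E1];
  by rewrite ?q2 ?q0 ?q1 ?mulr0 ?oppr0 ?expr0n.
Qed.

Lemma translate_double_cover p (u : C) :
  translate (double_cover p) [tuple u; 0] = double_cover (p \Po ('X + u%:P)).
Proof.
rewrite /translate comp_mpolyB comp_mpoly_horner_alg rmorphXn /= comp_mpolyXU /=.
rewrite mpolyC0 addr0; congr (_ - _); rewrite -horner_alg_comp; congr horner_alg.
by rewrite rmorphD /= horner_algX horner_algC alg_mpolyC.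
Qed.

Lemma taylor_form_double_cover p d (u : C) :
  taylor_form d (double_cover p) [tuple u; 0] =
  (if d == 2 then 'X_1 ^+ 2 else 0) - (p \Po ('X + u%:P))`_d *: 'X_0 ^+ d.
Proof.
rewrite /taylor_form translate_double_cover raddfB /= pihomog_horner_alg.
by rewrite mpolyXn pihomogX /= mdegMn mdeg1 mul1n eq_sym.
Qed.

Lemma coef_comp_scaleX p (c : C) i : (p \Po (c *: 'X))`_i = c ^+ i * p`_i.
Proof.
elim/poly_ind: p i => [|p a IHp] i; first by rewrite comp_poly0 coef0 mulr0.
rewrite comp_polyD comp_polyM comp_polyX comp_polyC !coefD !coefC -scalerAr coefZ.
rewrite !coefMX; case: i => [|i] /=; first by rewrite expr0 mul1r mulr0.
by rewrite IHp exprS mulrA !addr0.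
Qed.

(** Here [line_mult] parametrises the line by (l.2 t, 0), so the term y^2 drops out. *)
Lemma line_mult_double_cover p (u : C) (l : C * C) : l.1 = 0 ->
  line_mult (double_cover p) [tuple u; 0] l =
  mup 0 (- (p \Po ('X + u%:P) \Po (l.2 *: 'X))).
Proof.
move=> l1; rewrite /line_mult translate_double_cover raddfB /=.
rewrite mmap_polyC_horner_alg rmorphXn /= mmapX mmap1U /= !(tnth_nth 0) /=.
by rewrite l1 oppr0 scale0r expr0n sub0r.
Qed.

Lemma double_point_double_cover p (u : C) :
  double_point (double_cover p) [tuple u; 0] <-> p.[u] = 0 /\ p^`().[u] = 0.
Proof.
have [<- <- _ _] := coef_shift p u.
have ev (r : {mpoly C[2]}) v : r = 0 -> r.@[v] = 0 by move=> ->; rewrite meval0.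
rewrite /double_point !taylor_form_double_cover /= !sub0r expr0 expr1.
split=> [[/ev H0 /ev H1 _]|[-> ->]].
  have := H0 (fun=> 1); have := H1 (fun=> 1).
  rewrite !mevalN !mevalZ mevalXU meval1 !mulr1 => /eqP + /eqP.
  by rewrite !oppr_eq0 => /eqP-> /eqP->.
rewrite !scale0r oppr0; split=> //; apply: contraTneq isT => H.
(* Evaluation at (0, 1) isolates the coefficient 1 of y^2. *)
have := ev _ (tnth [tuple 0; 1]) H; rewrite mevalB mevalZ !rmorphXn /= !mevalXU.
rewrite !(tnth_nth 0) /= expr0n mulr0 subr0 expr1n => /eqP.
by rewrite oner_eq0.
Qed.

Lemma meval_linear_form (l : C * C) v :
  (linear_form l).@[v] = l.1 * v 0 + l.2 * v 1.
Proof. by rewrite mevalD !mevalZ !mevalXU. Qed.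

(** The quadratic form is y^2 - c x^2, without mixed term; coefficients are compared through the
    values at (1, 0), (0, 1) and (1, 1). *)
Lemma double_cover_tangent_cone p (u : C) (l l' : C * C) :
  taylor_form 2 (double_cover p) [tuple u; 0] = linear_form l * linear_form l' ->
  [/\ l.1 * l'.1 = - (p \Po ('X + u%:P))`_2, l.2 * l'.2 = 1
    & l.1 * l'.2 + l.2 * l'.1 = 0].
Proof.
rewrite taylor_form_double_cover /= => E.
have ev x y : y ^+ 2 - (p \Po ('X + u%:P))`_2 * x ^+ 2 =
    (l.1 * x + l.2 * y) * (l'.1 * x + l'.2 * y).
  move/(congr1 (meval (tnth [tuple x; y]))): E.
  by rewrite mevalM !meval_linear_form mevalB mevalZ !rmorphXn /= !mevalXU !(tnth_nth 0).
have E10 := ev 1 0; have E01 := ev 0 1; have E11 := ev 1 1.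
have E1 : l.1 * l'.1 = - (p \Po ('X + u%:P))`_2.
  transitivity ((l.1 * 1 + l.2 * 0) * (l'.1 * 1 + l'.2 * 0)); first by ring.
  by rewrite -E10; ring.
have E2 : l.2 * l'.2 = 1.
  transitivity ((l.1 * 0 + l.2 * 1) * (l'.1 * 0 + l'.2 * 1)); first by ring.
  by rewrite -E01; ring.
split=> //; transitivity
  ((l.1 * 1 + l.2 * 1) * (l'.1 * 1 + l'.2 * 1) - l.1 * l'.1 - l.2 * l'.2).
  ring.
by rewrite E1 E2 -E11; ring.
Qed.

(** If y^2 - c x^2 is a square l^2, the absence of a mixed term gives l.1 = 0 and c = 0, so the
    tangent is y = 0. The equation restricts to - p there, so multiplicity 3 means that p'''(u) is
    nonzero. *)
Lemma affine_cusp_double_cover p (u : C) :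
  affine_cusp (double_cover p) [tuple u; 0] <->
  [/\ p.[u] = 0, p^`().[u] = 0, p^`()^`().[u] = 0 & p^`()^`()^`().[u] <> 0].
Proof.
have [t0 t1 t2 t3] := coef_shift p u.
have mulrn_inj (x : C) n : x *+ n.+1 = 0 -> x = 0.
  by move/eqP; rewrite mulrn_eq0 => /eqP.
have mult3 (c : C) : c != 0 -> p.[u] = 0 -> p^`().[u] = 0 ->
    (p \Po ('X + u%:P))`_2 = 0 ->
    mup 0 (- (p \Po ('X + u%:P) \Po (c *: 'X))) = 3%N <-> p^`()^`()^`().[u] <> 0.
  move=> c0 p0 p1 p2; set r := - _.
  have Dr i : r`_i = - (c ^+ i * (p \Po ('X + u%:P))`_i).
    by rewrite coefN coef_comp_scaleX.
  have r3 : (r`_3 != 0) = (p^`()^`()^`().[u] != 0).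
    by rewrite -t3 Dr oppr_eq0 mulf_eq0 expf_eq0 (negPf c0) mulrn_eq0.
  (* If [r] = 0 the line is a component; [mup] is bounded by the size of its argument, hence is not
     3, and p'''(u) vanishes too. *)
  have [rz|nz_r] := eqVneq r 0.
    move: r3; rewrite rz coef0 eqxx => /esym/negbFE/eqP ->; split=> //.
    rewrite /mup; case: arg_maxnP => //= -[k lt_k] _ _ /= Dk.
    by move: lt_k; rewrite Dk size_poly0.
  have r012 i : (i < 3)%N -> r`_i = 0.
    by case: i => [|[|[|//]]] _; rewrite Dr ?t0 ?t1 ?p2 ?p0 ?p1 mulr0 oppr0.
  have E := mup0_eq nz_r r012.
  split=> [Em|/eqP p3]; first by apply/eqP; rewrite -r3 -E Em.
  by apply/eqP; rewrite E r3.
split=> [[/double_point_double_cover[p0 p1] [l [El]]]|[p0 p1 p2 p3]].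
  have [E1 E2 E3] : _ := double_cover_tangent_cone El.
  have l2 : l.2 != 0 by apply: contra_eq_neq E2 => ->; rewrite mul0r eq_sym oner_eq0.
  have l1 : l.1 = 0.
    move/eqP: E3; rewrite mulrC -mulr2n mulrn_eq0 /= mulf_eq0 (negPf l2) /=.
    by move/eqP.
  have c2 : (p \Po ('X + u%:P))`_2 = 0.
    by apply/eqP; rewrite -oppr_eq0 -E1 l1 mul0r.
  by rewrite line_mult_double_cover // => /(mult3 _ l2 p0 p1 c2) p3; rewrite -t2 c2 mul0rn.
split; [exact/double_point_double_cover | exists (0, 1)].
have c2 := mulrn_inj _ _ (etrans t2 p2).
split; last by rewrite line_mult_double_cover //; apply/mult3; rewrite ?oner_eq0.
by rewrite taylor_form_double_cover /= c2 /linear_form /= !scale0r subr0 add0r scale1r.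
Qed.

End DoubleCover.

(** The tangent cone is y^2 - c x^2. Closedness provides a square root s of c, and the factors s x +
    y and - s x + y are distinct exactly when s is nonzero. *)
Lemma affine_node_double_cover (C : numClosedFieldType) (p : {poly C}) (u : C) :
  affine_node (double_cover p) [tuple u; 0] <->
  [/\ p.[u] = 0, p^`().[u] = 0 & p^`()^`().[u] <> 0].
Proof.
have [_ _ t2 _] := coef_shift p u.
split=> [[/double_point_double_cover[p0 p1] [l [l' [neq_l El]]]]|[p0 p1 p2]].
  split=> //; rewrite -t2 => /eqP; rewrite mulrn_eq0 /= => /eqP c2.
  have [E1 _ E3] := double_cover_tangent_cone El.
  move: E1; rewrite c2 oppr0 => /eqP; rewrite mulf_eq0 => /orP[]/eqP l1.
    by move: E3 neq_l; rewrite l1 mul0r add0r => ->; rewrite eqxx.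
  by move: E3 neq_l; rewrite l1 mulr0 addr0 => ->; rewrite eqxx.
split; first exact/double_point_double_cover.
pose s := sqrtC (p \Po ('X + u%:P))`_2.
have Ds : s ^+ 2 = (p \Po ('X + u%:P))`_2 by rewrite sqrtCK.
have nz_s : s != 0.
  by apply: contra_notN p2 => /eqP s0; rewrite -t2 -Ds s0 expr0n mul0rn.
exists (s, 1), (- s, 1); split.
  by rewrite /= mulr1 mul1r -subr_eq0 opprK -mulr2n mulrn_eq0.
rewrite taylor_form_double_cover /= -Ds /linear_form /= scale1r scaleNr.
by rewrite -exprZn; ring.
Qed.

(** * The charts of the E7 curve *)

Lemma tuple2_eta (T : Type) (x0 : T) (p : 2.-tuple T) :
  p = [tuple nth x0 p 0; nth x0 p 1].
Proof. by apply: val_inj; case: p => [[|a [|b []]]]. Qed.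

Lemma tuple3_eta (T : Type) (x0 : T) (p : 3.-tuple T) :
  p = [tuple nth x0 p 0; nth x0 p 1; nth x0 p 2].
Proof. by apply: val_inj; case: p => [[|a [|b [|c []]]]]. Qed.

Lemma weq112P (C : fieldType) (p q : 3.-tuple C) :
  weq w112 p q <->
  exists2 t, t != 0 & [/\ q`_0 = t * p`_0, q`_1 = t * p`_1 & q`_2 = t ^+ 2 * p`_2].
Proof.
split=> [[t nz_t E]|[t nz_t [E0 E1 E2]]]; exists t => //.
  have := E ord_max; have := E (inord 1); have := E ord0.
  by rewrite !(tnth_nth 0) /= inordK.
by case=> [[|[|[|//]]] lt_i]; rewrite !(tnth_nth 0) /= ?expr1.
Qed.

Definition chart_poly (C : fieldType) (k : chart) (e f g : C) : {poly C} :=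
  match k with
  | Chart_z => 'X^4 + e *: 'X^2 + f *: 'X + g%:P
  | Chart_x => 1 + e *: 'X^2 + f *: 'X^3 + g *: 'X^4
  end.

Lemma chart_eqn_E7 (C : fieldType) k (e f g : C) :
  chart_eqn k (E7_curve e f g) = double_cover (chart_poly k e f g).
Proof.
have scaleE n (c : C) (F : {mpoly C[n]}) : c *: F = c%:MP * F by rewrite mul_mpolyC.
case: k; rewrite /= /double_cover /E7_curve /chart_poly !scaleE;
  rewrite !(rmorphB, rmorphD, rmorphM, rmorphXn) /= !comp_mpolyC !comp_mpolyXU /=;
  rewrite -!mul_polyC !(rmorphM, rmorphXn, rmorph1) /= !horner_algX !horner_algC;
  by rewrite !alg_mpolyC; ring.
Qed.

(** The first affine coordinate of (1 : a : 0) in each chart. *)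
Definition local_coord (C : fieldType) (k : chart) (a : C) : C :=
  match k with Chart_z => a | Chart_x => a^-1 end.

Section Charts.
Variable C : numClosedFieldType.
Implicit Types (e f g a b t : C) (p q : 3.-tuple C).

Lemma chart_pointE k a t : t != 0 -> in_chart k [tuple t; t * a; 0] ->
  chart_point k [tuple t; t * a; 0] = [tuple local_coord k a; 0].
Proof.
move=> nz_t; case: k; rewrite /= ?mul0r => nz; apply: val_inj => /=; congr [:: _; 0].
  by rewrite mulrAC divff // mul1r.
by rewrite invfM mulrA divff // mul1r.
Qed.

Lemma in_chart_x a t : in_chart Chart_x [tuple t; t * a; 0] -> a != 0.
Proof. by rewrite /= mulf_eq0 negb_or => /andP[]. Qed.

(** The hypothesis on [k] puts (1 : a : 0) in the chart. With q the quartic, [Chart_x] has u^4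
    q(1/u), whose value and derivative at 1/a are q(a) / a^4 and (4 q(a) - a q'(a)) / a^3. *)
Lemma chart_poly_root k e f g a : (k = Chart_x -> a != 0) ->
  double_root e f g a <->
  (chart_poly k e f g).[local_coord k a] = 0 /\
  (chart_poly k e f g)^`().[local_coord k a] = 0.
Proof.
case: k => /= nz_a.
  rewrite /double_root !(derivE, hornerE) /=.
  by split=> -[q0 q1]; split; [rewrite -q0|rewrite -q1|rewrite -q0|rewrite -q1]; ring.
have {}nz_a := nz_a erefl.
have E0 : (1 + e *: 'X^2 + f *: 'X^3 + g *: 'X^4).[a^-1] =
    (a ^+ 4 + e * a ^+ 2 + f * a + g) / a ^+ 4.
  by rewrite !hornerE /=; field.
have E1 : (1 + e *: 'X^2 + f *: 'X^3 + g *: 'X^4)^`().[a^-1] =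
    (4 * (a ^+ 4 + e * a ^+ 2 + f * a + g) - a * (4 * a ^+ 3 + 2 * e * a + f)) / a ^+ 3.
  by rewrite !(derivE, hornerE) /=; field.
rewrite E0 E1; split=> [[-> ->]|[]]; first by rewrite !(mulr0, mul0r) subrr mul0r.
move/eqP; rewrite mulf_eq0 invr_eq0 expf_eq0 (negPf nz_a) orbF => /eqP q0.
rewrite /double_root q0 mulr0 sub0r => /eqP.
rewrite mulf_eq0 invr_eq0 expf_eq0 (negPf nz_a) orbF oppr_eq0 mulf_eq0 (negPf nz_a).
by move/eqP.
Qed.

(** The value is q''(a) in both charts: the second derivative of u^4 q(1/u) is q''(1/u) plus
    multiples of q(1/u) and q'(1/u). *)
Lemma chart_poly_hess k e f g a : (k = Chart_x -> a != 0) ->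
  double_root e f g a ->
  (chart_poly k e f g)^`()^`().[local_coord k a] = 2 * (6 * a ^+ 2 + e).
Proof.
move=> nz_a /double_rootE[-> ->]; case: k nz_a => /= nz_a.
  by rewrite !(derivE, hornerE) /=; ring.
have {}nz_a := nz_a erefl; rewrite !(derivE, hornerE) /=; by field.
Qed.

(** The assumption on [e] is q''(a) = 0. Then only q'''(a) = 24 a remains, multiplied by - a^2 in
    [Chart_x]. *)
Lemma chart_poly_deriv3 k e f g a : (k = Chart_x -> a != 0) ->
  double_root e f g a -> e = - (6 * a ^+ 2) ->
  (chart_poly k e f g)^`()^`()^`().[local_coord k a] =
  if k is Chart_z then 24 * a else - (24 * a ^+ 3).
Proof.
move=> nz_a /double_rootE[-> ->] ->; case: k nz_a => /= nz_a.
  by rewrite !(derivE, hornerE) /=; ring.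
have {}nz_a := nz_a erefl; rewrite !(derivE, hornerE) /=; by field.
Qed.

Lemma E7_singularP e f g p :
  singular_at (E7_curve e f g) p <->
  exists2 a, double_root e f g a & weq w112 [tuple 1; a; 0] p.
Proof.
split=> [[k]|[a root_a /weq112P[t nz_t [/= p0 p1 p2]]]]; last first.
  have -> : p = [tuple t; t * a; 0] by rewrite (tuple3_eta 0 p) p0 p1 p2 mulr1 mulr0.
  exists Chart_z => //; rewrite chart_eqn_E7 chart_pointE //.
  apply/affine_singular_double_cover; rewrite /=.
  have nz_a : Chart_z = Chart_x -> a != 0 by [].
  by have /(chart_poly_root _ _ _ nz_a)[r0 r1] := root_a.
rewrite chart_eqn_E7 => in_k /affine_singular_double_cover[y0 r0 r1].
suff [t [a [nz_t nz_a Dp]]] : exists t a,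
    [/\ t != 0, k = Chart_x -> a != 0 & p = [tuple t; t * a; 0]].
  exists a; last by apply/weq112P; exists t; rewrite // Dp /= mulr1 mulr0.
  by apply/(chart_poly_root _ _ _ nz_a); rewrite Dp chart_pointE -?Dp // in r0 r1.
move: y0 r0 {r1}; rewrite (tuple3_eta 0 p) {1}[p](tuple3_eta 0); case: k in_k => /= nz.
  move/eqP; rewrite mulf_eq0 invr_eq0 expf_eq0 (negPf nz) orbF => /eqP -> _.
  by exists p`_0, (p`_1 / p`_0); split=> //; rewrite mulrC divfK.
move/eqP; rewrite mulf_eq0 invr_eq0 expf_eq0 (negPf nz) orbF => /eqP -> r0.
(* On z = 0 the polynomial of [Chart_x] takes the value 1, so no singular point lies there. *)
have nz0 : p`_0 != 0.
  apply: contra_eq_neq r0 => ->; rewrite mul0r !hornerE /=.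
  by rewrite !(expr0n, mulr0, addr0) oner_eq0.
by exists p`_0, (p`_1 / p`_0); split=> // [_|]; rewrite ?mulf_neq0 ?invr_eq0 // mulrC divfK.
Qed.

Lemma double_root_singular e f g a :
  double_root e f g a -> singular_at (E7_curve e f g) [tuple 1; a; 0].
Proof.
move=> root_a; apply/E7_singularP; exists a => //.
by apply/weq112P; exists 1; rewrite ?oner_eq0 // expr1n !mul1r.
Qed.

Lemma weq_double_root a b :
  weq w112 [tuple 1; a; 0] [tuple 1; b; 0] -> a = b.
Proof. by case/weq112P=> t _ [/= E0 -> _]; rewrite mulr1 in E0; rewrite -E0 mul1r. Qed.

Lemma E7_single_singularP e f g p :
  single_singular_point (E7_curve e f g) p <->
  exists t a, [/\ t != 0, p = [tuple t; t * a; 0], double_root e f g a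
    & forall b, double_root e f g b -> b = a].
Proof.
split=> [[_ /E7_singularP[a root_a /weq112P[t nz_t [/= p0 p1 p2]]] uniq_p]|].
  exists t, a; split=> //; first by rewrite (tuple3_eta 0 p) p0 p1 p2 mulr1 mulr0.
  move=> b /double_root_singular sing_b.
  have pt_b : is_point [tuple 1; b; 0] by rewrite /is_point /= oner_eq0.
  have /weq112P[s nz_s [/= E0 E1 _]] := uniq_p _ pt_b sing_b.
  by move: E0; rewrite E1 p0 p1 mulr1 mulrA => <-; rewrite mul1r.
case=> t [a [nz_t -> root_a uniq_a]]; split; first by rewrite /is_point /= nz_t.
  apply/E7_singularP; exists a => //; apply/weq112P; exists t => //=.
  by rewrite mulr1 mulr0.
move=> q _ /E7_singularP[b /uniq_a -> /weq112P[s nz_s [/= q0 q1 q2]]].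
apply/weq112P; exists (s / t); first by rewrite mulf_neq0 ?invr_eq0.
by rewrite /= q0 q1 q2 mulrA divfK // !mulr0 mulr1.
Qed.

(** The chart is existentially quantified in [node_at]: the forward direction treats both charts,
    while the converse uses [Chart_z], which always contains the point. *)
Lemma E7_nodeP e f g a t : t != 0 -> double_root e f g a ->
  node_at (E7_curve e f g) [tuple t; t * a; 0] <-> 6 * a ^+ 2 + e <> 0.
Proof.
have nz2 : (2 : C) != 0 by rewrite pnatr_eq0.
move=> nz_t root_a; split=> [[k in_k]|nz_h].
  have nz_a : k = Chart_x -> a != 0 by move=> Dk; move: in_k; rewrite Dk => /in_chart_x.
  rewrite chart_eqn_E7 chart_pointE // => /affine_node_double_cover[_ _].
  by rewrite chart_poly_hess // => + h0; rewrite h0 mulr0.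
have nz_a : Chart_z = Chart_x -> a != 0 by [].
exists Chart_z => //; rewrite chart_eqn_E7 chart_pointE //.
apply/affine_node_double_cover; have /(chart_poly_root _ _ _ nz_a)[r0 r1] := root_a.
split=> //; rewrite chart_poly_hess // => /eqP.
by rewrite mulf_eq0 (negPf nz2) => /eqP.
Qed.

Lemma E7_cuspP e f g a t : t != 0 -> double_root e f g a ->
  cusp_at (E7_curve e f g) [tuple t; t * a; 0] <->
  6 * a ^+ 2 + e = 0 /\ a <> 0.
Proof.
have nz2 : (2 : C) != 0 by rewrite pnatr_eq0.
have nz24 : (24 : C) != 0 by rewrite pnatr_eq0.
have De a' : 6 * a' ^+ 2 + e = 0 -> e = - (6 * a' ^+ 2).
  by move=> h0; apply/eqP; rewrite -addr_eq0 addrC h0.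
move=> nz_t root_a; split=> [[k in_k]|[h0 /eqP nz_a']].
  have nz_a : k = Chart_x -> a != 0 by move=> Dk; move: in_k; rewrite Dk => /in_chart_x.
  rewrite chart_eqn_E7 chart_pointE // => /affine_cusp_double_cover[_ _].
  rewrite chart_poly_hess // => /eqP; rewrite mulf_eq0 (negPf nz2) => /eqP h0.
  rewrite chart_poly_deriv3 //; last exact: De.
  move=> d3; split=> // a0; apply: d3; rewrite a0.
  by case: (k); rewrite ?expr0n mulr0 ?oppr0.
have nz_a : Chart_z = Chart_x -> a != 0 by [].
exists Chart_z => //; rewrite chart_eqn_E7 chart_pointE //.
apply/affine_cusp_double_cover; have /(chart_poly_root _ _ _ nz_a)[r0 r1] := root_a.
split=> //; first by rewrite chart_poly_hess // h0 mulr0.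
rewrite chart_poly_deriv3 //; last exact: De.
by apply/eqP; rewrite mulf_neq0.
Qed.

Lemma E7_nodalP e f g :
  nodal_curve (E7_curve e f g) <->
  exists a, [/\ double_root e f g a, forall b, double_root e f g b -> b = a
    & 6 * a ^+ 2 + e <> 0].
Proof.
split=> [[p [/E7_single_singularP[t [a [nz_t -> root_a uniq_a]]]]]|].
  by move/(E7_nodeP nz_t root_a); exists a.
have nz1 := oner_neq0 C; case=> a [root_a uniq_a nz_h].
exists [tuple 1; 1 * a; 0]; split; last exact/E7_nodeP.
by apply/E7_single_singularP; exists 1, a.
Qed.

Lemma E7_cuspidalP e f g :
  cuspidal_curve (E7_curve e f g) <->
  exists a, [/\ double_root e f g a, forall b, double_root e f g b -> b = a,
    6 * a ^+ 2 + e = 0 & a <> 0].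
Proof.
split=> [[p [/E7_single_singularP[t [a [nz_t -> root_a uniq_a]]]]]|].
  by case/(E7_cuspP nz_t root_a); exists a.
have nz1 := oner_neq0 C; case=> a [root_a uniq_a h0 nz_a].
exists [tuple 1; 1 * a; 0]; split; last exact/E7_cuspP.
by apply/E7_single_singularP; exists 1, a.
Qed.

Lemma E7_singular_curveP e f g :
  singular_curve (E7_curve e f g) <-> exists a, double_root e f g a.
Proof.
split=> [[p [_ /E7_singularP[a root_a _]]]|[a root_a]]; first by exists a.
exists [tuple 1; a; 0]; split; last exact: double_root_singular.
by rewrite /is_point /= oner_eq0.
Qed.

(** * Factorizations of the curve and common points of the factors *)

Lemma affine_singular_mul (G1 G2 : {mpoly C[2]}) (q : 2.-tuple C) :
  on_curve G1 q -> on_curve G2 q -> affine_singular (G1 * G2) q.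
Proof.
rewrite /affine_singular /on_curve !mderivM !mevalD !mevalM => -> ->.
by rewrite !(mul0r, mulr0) addr0.
Qed.

(* At a tangency both factors have order at least two along the common
   tangent line, so their product has order at least four there. *)
Lemma affine_tangent_double_cover (G1 G2 : {mpoly C[2]}) (P : {poly C})
    (q : 2.-tuple C) :
  G1 * G2 = double_cover P -> affine_tangent G1 G2 q ->
  P^`()^`().[q`_0] = 0 /\ P^`()^`()^`().[q`_0] = 0.
Proof.
move=> E [[G1q _] [G2q _]]; rewrite /jacobian /on_curve in G1q G2q *.
set v := tnth q in G1q G2q *.
have vE (i : 'I_2) : v i = q`_i by rewrite /v (tnth_nth 0).
rewrite mevalB !mevalM => Ej.
have E00 : (G1 * G2)^`M(0)^`M(0).@[v] = - P^`()^`().[q`_0].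
  rewrite E mderiv0_double_cover mderivN mderiv_horner_alg eqxx.
  by rewrite mevalN meval_horner_alg vE.
have E000 : (G1 * G2)^`M(0)^`M(0)^`M(0).@[v] = - P^`()^`()^`().[q`_0].
  rewrite E mderiv0_double_cover !mderivN mderiv_horner_alg eqxx mderiv_horner_alg eqxx.
  by rewrite mevalN meval_horner_alg vE.
have E11 : (G1 * G2)^`M(1)^`M(1).@[v] = 2.
  by rewrite E mderiv1_double_cover mderivZ mderivXU eqxx mevalZ meval1 mulr1.
have E10 : (G1 * G2)^`M(1)^`M(0).@[v] = 0.
  by rewrite E mderiv1_double_cover mderivZ mderivXU scaler0 meval0.
move: E00 E000 E11 E10; rewrite !(mderivM, mderivD) !(mevalD, mevalM) G1q G2q.
rewrite !(mul0r, mulr0, add0r, addr0).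
move: Ej; set A := (G1^`M(0)).@[v]; set B := (G1^`M(1)).@[v].
set A' := (G2^`M(0)).@[v]; set B' := (G2^`M(1)).@[v] => Ej E00 E000 E11 E10.
(* The second y-derivative of the product is 2 B B' = 2, so neither y-derivative vanishes. *)
have nz_BB : B * B' != 0.
  by apply: contra_eq_neq E11 => ->; rewrite addr0 eq_sym pnatr_eq0.
have [nz_B nz_B'] : B != 0 /\ B' != 0 by apply/andP; rewrite -negb_or -mulf_eq0.
have mul2_eq0 (x : C) : x *+ 2 = 0 -> x = 0 by move/eqP; rewrite mulrn_eq0 => /eqP.
(* The mixed derivative A B' + B A' and the Jacobian A B' - B A' both vanish, so A = A' = 0: the
   common tangent is horizontal. *)
have A0 : A = 0.
  apply: (mulIf nz_B'); rewrite mul0r; apply: mul2_eq0.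
  by transitivity (B * A' + A * B' + (A * B' - B * A')); [ring | rewrite E10 Ej addr0].
have A'0 : A' = 0.
  apply: (mulfI nz_B); rewrite mulr0; apply: mul2_eq0.
  by transitivity (B * A' + A * B' - (A * B' - B * A')); [ring | rewrite E10 Ej subr0].
(* Every remaining term of the second and third x-derivatives contains A or A'. *)
move: E00 E000; rewrite A0 A'0 !(mul0r, mulr0, addr0) => E00 E000.
by split; apply/eqP; rewrite -oppr_eq0 -?E00 -?E000.
Qed.

(** A tangency point is singular on the product, so it is (1 : a : 0) for a double root a; there q''
    = q''' = 0 gives e = - 6 a^2 and a = 0. *)
Lemma E7_tangent e f g (F1 F2 : {mpoly C[3]}) p :
  E7_curve e f g = F1 * F2 -> tangent_at F1 F2 p -> [/\ e = 0, f = 0 & g = 0].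
Proof.
move=> E [k in_k tan_p].
have E_k : chart_eqn k F1 * chart_eqn k F2 = double_cover (chart_poly k e f g).
  by rewrite -chart_eqn_E7 E; case: (k); rewrite /= rmorphM.
have sing_p : singular_at (E7_curve e f g) p.
  exists k => //; rewrite chart_eqn_E7 -E_k.
  by case: tan_p => -[on1 _] [on2 _] _; exact: affine_singular_mul.
have [h0 d30] := affine_tangent_double_cover E_k tan_p.
have /E7_singularP[a root_a /weq112P[t nz_t [/= p0 p1 p2]]] := sing_p.
have Dp : p = [tuple t; t * a; 0] by rewrite (tuple3_eta 0 p) p0 p1 p2 mulr1 mulr0.
have nz_a : k = Chart_x -> a != 0.
  by move=> Dk; move: in_k; rewrite Dk Dp => /in_chart_x.
rewrite Dp chart_pointE -?Dp //= in h0 d30.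
move: h0 d30; rewrite chart_poly_hess // => /eqP; rewrite mulf_eq0 pnatr_eq0 /= => /eqP h0.
have De : e = - (6 * a ^+ 2) by apply/eqP; rewrite -addr_eq0 addrC h0.
have a0 : (chart_poly k e f g)^`()^`()^`().[local_coord k a] = 0 -> a = 0.
  rewrite chart_poly_deriv3 //; case: (k) => /eqP.
    by rewrite mulf_eq0 pnatr_eq0 /= => /eqP.
  by rewrite oppr_eq0 mulf_eq0 pnatr_eq0 expf_eq0 /= => /eqP.
move/a0 => {}a0; have [-> ->] := proj1 (double_rootE _ _ _ _) root_a.
by rewrite De a0 !(expr0n, mulr0, oppr0, addr0).
Qed.

Lemma transversal_singular (F1 F2 : {mpoly C[3]}) p :
  transversal_at F1 F2 p -> singular_at (F1 * F2) p.
Proof.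
case=> k in_k [[on1 _] [on2 _] _]; exists k => //.
have -> : chart_eqn k (F1 * F2) = chart_eqn k F1 * chart_eqn k F2.
  by case: (k); rewrite /= rmorphM.
exact: affine_singular_mul.
Qed.

(** The two points are singular, so they yield distinct double roots, and [two_double_roots]
    applies. *)
Lemma E7_transversal e f g (F1 F2 : {mpoly C[3]}) p p' :
  E7_curve e f g = F1 * F2 -> transversal_at F1 F2 p -> transversal_at F1 F2 p' ->
  ~ weq w112 p p' -> [/\ g <> 0, f = 0 & e ^+ 2 = 4 * g].
Proof.
move=> E /transversal_singular + /transversal_singular; rewrite -E.
move=> /E7_singularP[a root_a /weq112P[t nz_t [/= p0 p1 p2]]].
move=> /E7_singularP[b root_b /weq112P[s nz_s [/= q0 q1 q2]]] neq_p.
have neq_ab : a != b.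
  apply: contra_notN neq_p => /eqP Dab; apply/weq112P; exists (s / t).
    by rewrite mulf_neq0 ?invr_eq0.
  by rewrite p0 p1 p2 q0 q1 q2 Dab !mulr0 !mulr1 mulrA divfK.
have [nz_a -> -> ->] := two_double_roots root_a root_b neq_ab.
by split=> //; [apply/eqP; rewrite expf_neq0 | ring].
Qed.

End Charts.

(** * The curves y = a x^2 + b z^2 *)

(** A section of the projection (z : x : y) -> (z : x), which is defined off the vertex. *)
Definition section_curve (C : fieldType) (a b : C) : {mpoly C[3]} :=
  'X_2 - (a *: 'X_1 ^+ 2 + b *: 'X_0 ^+ 2).

(** * Weighted homogeneous polynomials *)

Section WeightedHomogeneous.
Variables (C : fieldType) (n : nat) (w : n.-tuple nat).
Implicit Types (F G : {mpoly C[n]}).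

Lemma whomogD d F G : whomog w d F -> whomog w d G -> whomog w d (F + G).
Proof.
by move=> hF hG m /msuppD_le; rewrite mem_cat => /orP[/hF | /hG].
Qed.

Lemma whomogZ d c F : whomog w d F -> whomog w d (c *: F).
Proof. by move=> hF m /msuppZ_le /hF. Qed.

Lemma whomogN d F : whomog w d F -> whomog w d (- F).
Proof. by rewrite -scaleN1r; exact: whomogZ. Qed.

Lemma whomogXU i k : whomog w (tnth w i * k) ('X_i ^+ k : {mpoly C[n]}).
Proof.
rewrite mpolyXn => m; rewrite msuppX inE => /eqP ->.
rewrite (bigD1 i) //= mulmnE mnm1E eqxx mul1n big1 ?addn0 // => j neq_ji.
by rewrite mulmnE mnm1E eq_sym (negPf neq_ji) muln0.
Qed.

End WeightedHomogeneous.

(** Substitution is a morphism of algebras, hence determined by the images of the variables. *)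
Lemma comp_mpolyK (C : comNzRingType) n k (t : n.-tuple {mpoly C[k]})
    (u : k.-tuple {mpoly C[n]}) (F : {mpoly C[n]}) :
  (forall i, tnth t i \mPo u = 'X_i) -> (F \mPo t) \mPo u = F.
Proof.
move=> tK; rewrite {2}(mpolyE F) {1}(mpolyE F).
rewrite (raddf_sum (comp_mpoly t)) (raddf_sum (comp_mpoly u)).
apply: eq_bigr => m _ /=.
rewrite !comp_mpolyZ comp_mpolyX rmorph_prod mpolyXE_id; congr (_ *: _).
by apply: eq_bigr => i _; rewrite rmorphXn /= tK.
Qed.

Section SectionCurve.
Variable C : fieldType.
Implicit Types (a b : C).

Lemma on_section_curve a b (p : 3.-tuple C) :
  on_curve (section_curve a b) p <-> p`_2 = a * p`_1 ^+ 2 + b * p`_0 ^+ 2.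
Proof.
rewrite /on_curve !(mevalB, mevalD, mevalZ) !rmorphXn /= !mevalXU !(tnth_nth 0) /=.
by split=> [/eqP|->]; rewrite ?subrr // subr_eq0 => /eqP.
Qed.

Lemma whomog_section_curve a b : whomog w112 2 (section_curve a b).
Proof.
have hU i d : (tnth w112 i * d = 2)%N -> whomog w112 2 ('X_i ^+ d : {mpoly C[3]}).
  by move=> E; have := @whomogXU C 3 w112 i d; rewrite E.
apply: whomogD; first by apply: (hU _ 1%N).
by apply/whomogN/whomogD; apply/whomogZ/hU.
Qed.

(* Up to the automorphism y -> y + a x^2 + b z^2 the section curve is y = 0. *)
Lemma irreducible_section_curve a b : irreducible_curve (section_curve a b).
Proof.
pose Q : {mpoly C[3]} := a *: 'X_1 ^+ 2 + b *: 'X_0 ^+ 2.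
pose s (c : C) := [tuple 'X_0; 'X_1; 'X_2 + c *: Q].
have meval_section : (section_curve a b).@[fun=> 0] = 0.
  rewrite !(mevalB, mevalD, mevalZ) !rmorphXn /= !mevalXU.
  by rewrite expr0n !mulr0 addr0 subr0.
split.
- by exists 2; exact: whomog_section_curve.
- apply/eqP=> /(congr1 (meval (tnth [tuple 0; 0; 1]))); rewrite meval0.
  rewrite !(mevalB, mevalD, mevalZ) !rmorphXn /= !mevalXU !(tnth_nth 0) /=.
  by rewrite expr0n !mulr0 addr0 subr0 => /eqP; rewrite oner_eq0.
- apply/negP => /mulrV /(congr1 (meval (fun=> 0))) /eqP.
  by rewrite mevalM meval_section mul0r meval1 eq_sym oner_eq0.
move=> G H E.
(* [Q] does not involve y, so it is fixed by [s c], and [s (-1)] inverts [s 1]. *)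
have Qs c : Q \mPo s c = Q.
  by rewrite rmorphD /= !comp_mpolyZ !rmorphXn /= !comp_mpolyXU.
have sK F : (F \mPo s 1) \mPo s (-1) = F.
  apply: comp_mpolyK => -[[|[|[|//]]] lt_i]; rewrite (tnth_nth 0) /=.
  + by rewrite comp_mpolyXU; congr 'X_ _; apply: val_inj.
  + by rewrite comp_mpolyXU; congr 'X_ _; apply: val_inj.
  rewrite scale1r rmorphD /= Qs comp_mpolyXU /= scaleN1r addrNK.
  by congr 'X_ _; apply: val_inj.
have E' : (G \mPo s 1) * (H \mPo s 1) = 'X_2.
  rewrite -rmorphM /= -E rmorphB /= Qs comp_mpolyXU /= scale1r.
  by rewrite addrK.
have unit_of F : msize (F \mPo s 1) = 1%N -> F \is a GRing.unit.
  move/eqP/msize_poly1P=> [c nz_c DF].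
  by rewrite -(sK F) DF comp_mpolyC -alg_mpolyC scaler_unit ?unitr1 ?unitfE.
have /andP[nzG nzH] : ((G \mPo s 1) != 0) && ((H \mPo s 1) != 0).
  rewrite -negb_or -mulf_eq0 E'; apply/eqP=> /(congr1 (meval (fun=> 1))) /eqP.
  by rewrite mevalXU meval0 oner_eq0.
(* [msize] is the total degree plus 1, so the sizes of the two nonzero factors add up to 3 and one
   of the factors is constant. *)
have := msizeM nzG nzH; rewrite E' msizeX mdeg1.
move: (msize_poly_eq0 (G \mPo s 1)) (msize_poly_eq0 (H \mPo s 1)).
rewrite (negPf nzG) (negPf nzH).
case EG: (msize _) => [|[|m]] //; first by left; exact: unit_of.
case EH: (msize _) => [|[|k]] //; first by right; exact: unit_of.
by rewrite !addnS.
Qed.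

Definition section_poly k a b : {poly C} :=
  match k with Chart_z => a *: 'X^2 + b%:P | Chart_x => a%:P + b *: 'X^2 end.

Lemma chart_eqn_section_curve k a b :
  chart_eqn k (section_curve a b) = 'X_1 - horner_alg 'X_0 (section_poly k a b).
Proof.
have scaleE n (c : C) (F : {mpoly C[n]}) : c *: F = c%:MP * F by rewrite mul_mpolyC.
case: k; rewrite /= /section_curve !scaleE;
  rewrite !(rmorphB, rmorphD, rmorphM, rmorphXn) /= !comp_mpolyC !comp_mpolyXU /=;
  rewrite -!mul_polyC !(rmorphM, rmorphXn, rmorph1) /= !horner_algX !horner_algC;
  by rewrite !alg_mpolyC; ring.
Qed.

Lemma mderiv0_section k a b :
  (chart_eqn k (section_curve a b))^`M(0) = - horner_alg 'X_0 (section_poly k a b)^`().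
Proof.
rewrite chart_eqn_section_curve mderivB mderiv_horner_alg eqxx mderivXU.
by rewrite sub0r.
Qed.

Lemma mderiv1_section k a b : (chart_eqn k (section_curve a b))^`M(1) = 1.
Proof.
by rewrite chart_eqn_section_curve mderivB mderiv_horner_alg subr0 mderivXU.
Qed.

(** The curve is a graph: its derivative in the second coordinate is 1. *)
Lemma affine_nonsingular_section_curve k a b p :
  in_chart k p -> on_curve (section_curve a b) p ->
  affine_nonsingular (chart_eqn k (section_curve a b)) (chart_point k p).
Proof.
move=> in_k /on_section_curve on_p; split.
  rewrite /on_curve chart_eqn_section_curve mevalB mevalXU meval_horner_alg.
  rewrite !(tnth_nth 0); case: k in_k => /= nz; rewrite on_p !hornerE /=; by field.
by case=> _ _; rewrite /on_curve mderiv1_section meval1 => /eqP; rewrite oner_eq0.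
Qed.

(** Up to sign the Jacobian of two graphs is the difference of their slopes. *)
Lemma on_curve_jacobian_section k a b a' b' (q : 2.-tuple C) :
  on_curve (jacobian (chart_eqn k (section_curve a b))
                     (chart_eqn k (section_curve a' b'))) q
  <-> (section_poly k a b)^`().[q`_0] = (section_poly k a' b')^`().[q`_0].
Proof.
rewrite /on_curve /jacobian !mderiv0_section !mderiv1_section mulr1 mul1r.
rewrite mevalB !mevalN !meval_horner_alg !(tnth_nth 0) /= opprK addrC.
by split=> [/eqP|->]; rewrite ?subrr // subr_eq0 => /eqP.
Qed.

Lemma nonsingular_section_curve a b : nonsingular_curve (section_curve a b).
Proof.
move=> p pt_p on_p.
(* A point outside both charts would have z = x = 0, and the equation would then force y = 0. *)
have [k in_k] : exists k, in_chart k p.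
  have [p0|] := eqVneq p`_0 0; last by exists Chart_z.
  have [p1|] := eqVneq p`_1 0; last by exists Chart_x.
  move/on_section_curve: on_p; rewrite p0 p1 expr0n !mulr0 addr0 => p2.
  by move: pt_p; rewrite /is_point (tuple3_eta 0 p) p0 p1 p2 /= eqxx.
by exists k => //; exact: affine_nonsingular_section_curve.
Qed.

(** The projection to (z : x) and its section are inverse everywhere on the curve and on P^1, so
    both exceptional sets are empty. *)
Lemma rational_section_curve a b : birational_to_P1 (section_curve a b).
Proof.
have weq_refl n (w : n.-tuple nat) (p : n.-tuple C) : weq w p p.
  by exists 1 => [|i]; rewrite ?oner_eq0 // expr1n mul1r.
pose phi : 3.-tuple {mpoly C[2]} :=
  [tuple 'X_0; 'X_1; a *: 'X_1 ^+ 2 + b *: 'X_0 ^+ 2].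
pose psi : 2.-tuple {mpoly C[3]} := [tuple 'X_0; 'X_1].
have phiE s : ratmap phi s = [tuple s`_0; s`_1; a * s`_1 ^+ 2 + b * s`_0 ^+ 2].
  apply: eq_from_tnth => -[[|[|[|//]]] lt_i]; rewrite tnth_mktuple !(tnth_nth 0) /=;
  by rewrite ?(mevalD, mevalZ) ?rmorphXn /= !mevalXU !(tnth_nth 0).
have psiE p : ratmap psi p = [tuple p`_0; p`_1].
  apply: eq_from_tnth => -[[|[|//]] lt_i]; rewrite tnth_mktuple !(tnth_nth 0) /=;
  by rewrite !mevalXU !(tnth_nth 0).
exists phi, psi, [::], [::]; split.
- exists 1%N => -[[|[|[|//]]] lt_i]; rewrite !(tnth_nth 0) /=.
  + exact: (@whomogXU C 2 w11 0 1).
  + exact: (@whomogXU C 2 w11 1 1).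
  by apply: whomogD; apply: whomogZ;
    [exact: (@whomogXU C 2 w11 1 2) | exact: (@whomogXU C 2 w11 0 2)].
- exists 1%N => -[[|[|//]] lt_i]; rewrite !(tnth_nth 0) /=.
  + exact: (@whomogXU C 3 w112 0 1).
  + exact: (@whomogXU C 3 w112 1 1).
- move=> s pt_s _; rewrite phiE psiE /= -(tuple2_eta 0 s); split=> //.
    by move: pt_s; rewrite {1}(tuple2_eta 0 s) /is_point /= orbF orbA => ->.
  by apply/on_section_curve.
move=> p pt_p on_p _; rewrite psiE phiE /=.
move: (on_p) => /on_section_curve <-; rewrite -(tuple3_eta 0 p); split=> //.
move: pt_p; rewrite {1}(tuple3_eta 0 p) /is_point /= !orbF.
case: eqVneq => //= p0; case: eqVneq => //= p1.
by move/on_section_curve: on_p => ->; rewrite p0 p1 expr0n !mulr0 addr0 eqxx.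
Qed.

Lemma nonsingular_rational_section_curve a b :
  nonsingular_rational_curve (section_curve a b).
Proof.
split; [exact: irreducible_section_curve | exact: nonsingular_section_curve
  | exact: rational_section_curve].
Qed.

End SectionCurve.

(** * Classification *)

Section Classification.
Variable C : numClosedFieldType.
Implicit Types (e f g a b : C).

(** Difference of squares for y^2 - (x^2 - a^2 z^2)^2; a = 0 is allowed and gives y^2 = x^4. *)
Lemma E7_curve_split a :
  E7_curve (- (2 * a ^+ 2)) 0 (a ^+ 4) =
  section_curve 1 (- a ^+ 2) * section_curve (-1) (a ^+ 2).
Proof.
by rewrite /E7_curve /section_curve -!mul_mpolyC !(rmorphN, rmorphM, rmorphXn) /=; ring.
Qed.

(** The two equations amount to y = 0 and x^2 = a^2 z^2; as z = 0 would force x = 0, one can take b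
    = x/z. *)
Lemma on_both_sections a p :
  on_both (section_curve 1 (- a ^+ 2)) (section_curve (-1) (a ^+ 2)) p <->
  exists2 b, b ^+ 2 = a ^+ 2 & weq w112 [tuple 1; b; 0] p.
Proof.
split=> [[pt_p /on_section_curve E1 /on_section_curve E2]|[b Db]]; last first.
  case/weq112P=> t nz_t [/= p0 p1 p2]; split; last 2 first.
  - by apply/on_section_curve; rewrite p0 p1 p2 exprMn Db; ring.
  - by apply/on_section_curve; rewrite p0 p1 p2 exprMn Db; ring.
  by rewrite /is_point (tuple3_eta 0 p) /= p0 mulr1 nz_t.
have p2 : p`_2 = 0.
  have /eqP : p`_2 *+ 2 = 0 by rewrite mulr2n {1}E1 E2; ring.
  by rewrite mulrn_eq0 => /eqP.
have p12 : p`_1 ^+ 2 = a ^+ 2 * p`_0 ^+ 2.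
  by move/eqP: (esym E1); rewrite p2 mul1r mulNr subr_eq0 => /eqP.
have nz0 : p`_0 != 0.
  apply: contraTneq pt_p => p0; move/eqP: p12; rewrite p0 expr0n mulr0 expf_eq0 /=.
  by move=> /eqP p1; rewrite /is_point (tuple3_eta 0 p) /= p0 p1 p2 eqxx.
exists (p`_1 / p`_0); first by rewrite expr_div_n p12 mulfK // expf_neq0.
by apply/weq112P; exists p`_0 => //=; rewrite mulr1 mulr0 p2 mulrC divfK.
Qed.

(** At x = b the two graphs have slopes 2 b and - 2 b. *)
Lemma sections_at a b : b ^+ 2 = a ^+ 2 ->
  let p := [tuple 1; b; 0] in
  [/\ on_both (section_curve 1 (- a ^+ 2)) (section_curve (-1) (a ^+ 2)) p,
      b = 0 -> tangent_at (section_curve 1 (- a ^+ 2)) (section_curve (-1) (a ^+ 2)) p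
    & b != 0 ->
      transversal_at (section_curve 1 (- a ^+ 2)) (section_curve (-1) (a ^+ 2)) p].
Proof.
move=> Db p.
have on_p : on_both (section_curve 1 (- a ^+ 2)) (section_curve (-1) (a ^+ 2)) p.
  apply/on_both_sections; exists b => //.
  by exists 1 => [|i]; rewrite ?oner_eq0 // expr1n mul1r.
have in_z : in_chart Chart_z p by rewrite /= oner_eq0.
have [_ on1 on2] := on_p.
have ns1 := affine_nonsingular_section_curve in_z on1.
have ns2 := affine_nonsingular_section_curve in_z on2.
have jacP : on_curve (jacobian (chart_eqn Chart_z (section_curve 1 (- a ^+ 2)))
    (chart_eqn Chart_z (section_curve (-1) (a ^+ 2)))) (chart_point Chart_z p) <-> b = 0.
  have D (c d : C) : (section_poly Chart_z c d)^`().[(chart_point Chart_z p)`_0] = 2 * c * b.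
    by rewrite /= divr1 !(derivE, hornerE) /=; ring.
  split=> [/on_curve_jacobian_section|b0].
    rewrite !D => /eqP; rewrite -subr_eq0.
    have -> : 2 * 1 * b - 2 * -1 * b = b *+ 4 by ring.
    by rewrite mulrn_eq0 => /eqP.
  by apply/on_curve_jacobian_section; rewrite !D b0 !mulr0.
split=> // b0; exists Chart_z => //; split=> //; first exact/jacP.
by move/jacP; exact/eqP.
Qed.

Lemma E7_Delta4P e f g :
  two_tangent_rational_curves (E7_curve e f g) <-> [/\ e = 0, f = 0 & g = 0].
Proof.
split=> [[F1 [F2 [E _ _ [p [_ tan_p _]]]]]|[-> -> ->]]; first exact: E7_tangent E tan_p.
have sq0 : 0 ^+ 2 = 0 ^+ 2 :> C by [].
exists (section_curve 1 (- 0 ^+ 2)), (section_curve (-1) (0 ^+ 2)); split.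
- by rewrite -E7_curve_split !expr0n /= mulr0 oppr0.
- exact: nonsingular_rational_section_curve.
- exact: nonsingular_rational_section_curve.
exists [tuple 1; 0; 0]; have [on_p tan_p _] := sections_at sq0; split=> //.
  exact: tan_p.
by move=> q /on_both_sections[b /eqP]; rewrite expr0n expf_eq0 /= => /eqP ->.
Qed.

(** The conditions say that the quartic is (x^2 - a^2)^2, with a^2 = - e/2. *)
Lemma square_e_double_root e f g : g <> 0 -> f = 0 -> e ^+ 2 = 4 * g ->
  exists a, [/\ a != 0, e = - (2 * a ^+ 2), f = 0 & g = a ^+ 4].
Proof.
move=> nz_g f0 Eg; pose a := sqrtC (- (e / 2)); exists a.
have Da : a ^+ 2 = - (e / 2) by rewrite sqrtCK.
have nz2 : (2 : C) != 0 by rewrite pnatr_eq0.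
have De : e = - (2 * a ^+ 2) by rewrite Da; field.
have Dg : g = a ^+ 4.
  apply: (@mulfI _ 4); first by rewrite pnatr_eq0.
  by rewrite -Eg De; ring.
by split=> //; apply: contra_notN nz_g => /eqP a0; rewrite Dg a0 expr0n.
Qed.

Lemma E7_Delta22P e f g :
  two_transversal_rational_curves (E7_curve e f g) <->
  [/\ g <> 0, f = 0 & e ^+ 2 = 4 * g].
Proof.
split=> [[F1 [F2 [E _ _ [p [p' [neq_p [_ tr_p] [_ tr_p'] _]]]]]]|[nz_g f0 Eg]].
  exact: E7_transversal E tr_p tr_p' neq_p.
have [a [nz_a -> -> ->]] := square_e_double_root nz_g f0 Eg.
exists (section_curve 1 (- a ^+ 2)), (section_curve (-1) (a ^+ 2)); split.
- exact: E7_curve_split.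
- exact: nonsingular_rational_section_curve.
- exact: nonsingular_rational_section_curve.
exists [tuple 1; a; 0], [tuple 1; - a; 0].
have [on_p _ tr_p] := sections_at (erefl (a ^+ 2)).
have [on_p' _ tr_p'] := sections_at (sqrrN a).
split.
- by move/weq_double_root/eqP; rewrite -subr_eq0 opprK -mulr2n mulrn_eq0 (negPf nz_a).
- by split; last exact: tr_p.
- by split; last by apply: tr_p'; rewrite oppr_eq0.
move=> q /on_both_sections[b /eqP]; rewrite eqf_sqr => /orP[] /eqP ->; by [left | right].
Qed.

(** Both sides describe a nonzero triple root: the quartic is (x - a)^3 (x + 3 a), with e = - 6 a^2,
    f = 8 a^3 and g = - 3 a^4. *)
Lemma cusp_double_rootP e f g :
  [/\ e <> 0, 8 * e ^+ 3 + 27 * f ^+ 2 = 0 & e ^+ 2 + 12 * g = 0] <->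
  exists a, [/\ double_root e f g a, 6 * a ^+ 2 + e = 0 & a <> 0].
Proof.
split=> [[/eqP nz_e Ef Eg]|[a [/double_rootE[-> ->] h0 nz_a]]]; last first.
  have -> : e = - (6 * a ^+ 2) by apply/eqP; rewrite -addr_eq0 addrC h0.
  split; try ring; apply/eqP; rewrite oppr_eq0 mulf_neq0 ?pnatr_eq0 // expf_neq0 //.
  exact/eqP.
(* The quotient of f = 8 a^3 by e = - 6 a^2 determines a. *)
pose a := - (3 * f) / (4 * e); exists a.
have nz4 : (4 : C) != 0 by rewrite pnatr_eq0.
have nz3 : (3 : C) != 0 by rewrite pnatr_eq0.
have h0 : 6 * a ^+ 2 + e = 0.
  transitivity ((8 * e ^+ 3 + 27 * f ^+ 2) / (8 * e ^+ 2)); last by rewrite Ef mul0r.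
  by rewrite /a; field.
have De : e = - (6 * a ^+ 2) by apply/eqP; rewrite -addr_eq0 addrC h0.
split=> //; last by move=> a0; move/eqP: nz_e; rewrite De a0 expr0n mulr0 oppr0.
apply/double_rootE; split.
  transitivity (- (4 * e * a / 3)); first by rewrite /a; field.
  by rewrite De; field.
apply: (@mulfI _ 12); first by rewrite pnatr_eq0.
by apply/eqP; rewrite -subr_eq0 -Eg De; apply/eqP; ring.
Qed.

Lemma E7_Delta13P e f g :
  cuspidal_curve (E7_curve e f g) <->
  [/\ e <> 0, 8 * e ^+ 3 + 27 * f ^+ 2 = 0 & e ^+ 2 + 12 * g = 0].
Proof.
split=> [/E7_cuspidalP[a [root_a _ h0 nz_a]]|/cusp_double_rootP[a [root_a h0 nz_a]]].
  by apply/cusp_double_rootP; exists a.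
apply/E7_cuspidalP; exists a; split=> // b root_b; apply/eqP.
apply: contra_notT nz_a; rewrite eq_sym => neq_ab.
(* A second double root would give e = - 2 a^2, against e = - 6 a^2 with a nonzero. *)
have [_ De _ _] := two_double_roots root_a root_b neq_ab.
have /eqP : a ^+ 2 *+ 4 = 0 by rewrite -[RHS]h0 De; ring.
by rewrite mulrn_eq0 expf_eq0 => /eqP.
Qed.

(** A node amounts to a unique double root a with q''(a) nonzero. Failure of uniqueness is the case
    [Delta22]; q''(a) = 0 is [Delta13] if a is nonzero and [Delta4] if a = 0. *)
Lemma E7_Delta112P e f g :
  nodal_curve (E7_curve e f g) <->
  [/\ discr e f g = 0, ~ [/\ e = 0, f = 0 & g = 0],
      ~ [/\ g <> 0, f = 0 & e ^+ 2 = 4 * g]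
    & ~ [/\ e <> 0, 8 * e ^+ 3 + 27 * f ^+ 2 = 0 & e ^+ 2 + 12 * g = 0]].
Proof.
split=> [/E7_nodalP[a [root_a uniq_a nz_h]]|[/discr_eq0[a root_a] n4 n22 n13]].
  split; first by apply/discr_eq0; exists a.
  - case=> e0 f0 g0; apply: nz_h; move: (root_a.2); rewrite e0 f0.
    have -> : 4 * a ^+ 3 + 2 * 0 * a + 0 = a ^+ 3 *+ 4 by ring.
    by move/eqP; rewrite mulrn_eq0 expf_eq0 /= => /eqP ->; rewrite expr0n mulr0 addr0.
  - case=> nz_g f0 Eg; have [r [nz_r De Df Dg]] := square_e_double_root nz_g f0 Eg.
    have /uniq_a Dr : double_root e f g r by rewrite De Df Dg; split; ring.
    have /uniq_a Dr' : double_root e f g (- r) by rewrite De Df Dg; split; ring.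
    move/eqP: (etrans Dr (esym Dr')); rewrite -subr_eq0 opprK -mulr2n mulrn_eq0.
    by rewrite (negPf nz_r).
  by case/cusp_double_rootP=> r [/uniq_a -> h0 _].
apply/E7_nodalP; exists a; split=> // [b root_b|h0].
  apply/eqP; apply: contra_notT n22; rewrite eq_sym => neq_ab.
  have [nz_a -> -> ->] := two_double_roots root_a root_b neq_ab.
  by split=> //; [apply/eqP; rewrite expf_neq0 | ring].
have [a0|/eqP nz_a] := eqVneq a 0; last by apply: n13; apply/cusp_double_rootP; exists a.
apply: n4; have e0 : e = 0 by rewrite -h0 a0; ring.
by have [-> ->] := proj1 (double_rootE _ _ _ _) root_a; rewrite e0 a0; split=> //; ring.
Qed.

End Classification.

Theorem mainTheorem10 (R : realType) (e f g : R[i]) :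
  let E := E7_curve e f g in
  let c4 := [/\ e = 0, f = 0 & g = 0] in
  let c22 := [/\ g <> 0, f = 0 & e ^+ 2 = 4 * g] in
  let c13 := [/\ e <> 0, 8 * e ^+ 3 + 27 * f ^+ 2 = 0 & e ^+ 2 + 12 * g = 0] in
  [/\ singular_curve E <-> discr e f g = 0,
      discr e f g = 0 -> exists! k, has_type E k
    & [/\ has_type E Delta4 <-> c4,
          has_type E Delta22 <-> c22,
          has_type E Delta13 <-> c13
        & has_type E Delta112 <->
            [/\ discr e f g = 0, ~ c4, ~ c22 & ~ c13]]].
Proof.
move=> E c4 c22 c13.
have T4 : has_type E Delta4 <-> c4 := E7_Delta4P e f g.
have T22 : has_type E Delta22 <-> c22 := E7_Delta22P e f g.
have T13 : has_type E Delta13 <-> c13 := E7_Delta13P e f g.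
have T112 : has_type E Delta112 <-> [/\ discr e f g = 0, ~ c4, ~ c22 & ~ c13] :=
  E7_Delta112P e f g.
split=> //.
  split=> [/E7_singular_curveP/discr_eq0 //|].
  by move/discr_eq0/E7_singular_curveP.
move=> D0.
(* Since each type is equivalent to its condition, uniqueness of the type reduces to the
   incompatibility of the conditions. *)
have c4_22 : c4 -> ~ c22 by case=> _ _ g0 [].
have c4_13 : c4 -> ~ c13 by case=> e0 _ _ [].
(* With f = 0 the cuspidal equation 8 e^3 + 27 f^2 = 0 forces e = 0. *)
have c22_13 : c22 -> ~ c13.
  case=> _ f0 _ [nz_e + _]; rewrite f0 expr0n mulr0 addr0 => /eqP.
  by rewrite mulf_eq0 pnatr_eq0 expf_eq0 => /eqP.
(* Classical case analysis on the three conditions; when all fail, the vanishing of the discriminant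
   leaves the nodal type. *)
have [k Tk] : exists k, has_type E k.
  have [h4|n4] := boolp.pselect c4; first by exists Delta4; apply/T4.
  have [h22|n22] := boolp.pselect c22; first by exists Delta22; apply/T22.
  have [h13|n13] := boolp.pselect c13; first by exists Delta13; apply/T13.
  by exists Delta112; apply/T112.
exists k; split=> // k'.
case: k Tk => [/T4 h|/T22 h|/T13 h|/T112[_ n4 n22 n13]];
  case: k' => [/T4 h'|/T22 h'|/T13 h'|/T112[_ n4' n22' n13']] //; exfalso;
  first [exact: c4_22 h' h | exact: c4_13 h' h | exact: c22_13 h' h | exact: c4_22 h h'
     | exact: c4_13 h h' | exact: c22_13 h h' | auto].
Qed.
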